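(* Every polylagrangian vector space admits a canonical basis. That is, let $V$ and $\hat T$ be finite-dimensional real vector spaces, let $\hat\omega$ be a $\hat T$-valued polylagrangian $(k+1)$-form of rank $N$ on $V$, and let $\{\hat e_a\mid1\le a\le\hat n\}$ be any basis of $\hat T$. Then there exists a basis $$\{\,e_i,\;e_a^{i_1\ldots i_k}\mid1\le a\le\hat n,\;1\le i\le N,\;1\le i_1<\ldots<i_k\le N\,\}$$ of a subspace of $V$ complementary to $\ker\hat\omega$ such that, denoting by $\{e^i,e^a_{i_1\ldots i_k}\}$ the corresponding dual basis (extended by zero on $\ker\hat\omega$ to linear forms on $V$), $$\hat\omega=\frac1{k!}\bigl(e^a_{i_1\ldots i_k}\wedge e^{i_1}\wedge\ldots\wedge e^{i_k}\bigr)\otimes\hat e_a .$$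
   Context: Here $k\ge1$. Summation over repeated indices is understood, with $e^a_{i_1\ldots i_k}$ extended totally antisymmetrically in $i_1,\dots,i_k$, so that $\frac1{k!}\sum_{i_1,\dots,i_k}=\sum_{i_1<\dots<i_k}$. For $\hat\omega\in\bigwedge^{k+1}V^*\otimes\hat T$ let $\hat\omega^\flat:V\to\bigwedge^kV^*\otimes\hat T$, $\hat\omega^\flat(v)=\mathrm i_v\hat\omega$, and $\ker\hat\omega=\ker\hat\omega^\flat$. For a subspace $L\subset V$, $L^\perp\subset V^*$ is its annihilator. A non-vanishing $\hat\omega$ is polylagrangian of rank $N$ if $V$ has a subspace $L$ of codimension $N$ (a polylagrangian subspace) with $\hat\omega^\flat(L)=(\bigwedge^kL^\perp)\otimes\hat T$. A polylagrangian vector space is a vector space $V$ equipped with such a form. When $\hat\omega$ is degenerate, a canonical basis of $V$ means a basis $\{e_i,e_a^{i_1\ldots i_k}\mid1\le a\le\hat n,\;1\le i\le N,\;1\le i_1<\ldots<i_k\le N\}$ of a subspace of $V$ complementary to $\ker\hat\omega$ such that, in terms of the corresponding dual basis $\{e^i,e^a_{i_1\ldots i_k}\}$ (extended by zero on $\ker\hat\omega$), $\hat\omega=\frac1{k!}\bigl(e^a_{i_1\ldots i_k}\wedge e^{i_1}\wedge\ldots\wedge e^{i_k}\bigr)\otimes\hat e_a$. *)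

(* Defs.v *)
From HB Require Import structures.
From mathcomp Require Import all_boot all_order all_algebra all_fingroup.
From mathcomp Require Import boolp classical_sets reals.

Set Implicit Arguments.
Unset Strict Implicit.
Unset Printing Implicit Defensive.

Import Order.TTheory GRing.Theory Num.Theory.
Local Open Scope classical_set_scope.
Local Open Scope ring_scope.

Section Forms.
Context {R : realType} {V T : vectType R}.
Implicit Types (k N n : nat) (L W : {vspace V}).

Definition fcons (A : Type) k (x : A) (v : 'I_k -> A) : 'I_k.+1 -> A :=
  fun p => oapp v x (unlift ord0 p).

Definition multilinear k (f : ('I_k -> V) -> T) : Prop :=
  forall (p : 'I_k) (v : 'I_k -> V),
    linear (fun x : V => f (fun q => if q == p then x else v q)).

Definition alternating k (f : ('I_k -> V) -> T) : Prop :=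
  forall (v : 'I_k -> V) (p q : 'I_k), p != q -> v p = v q -> f v = 0.

(* An element of (/\^k V^* ) (x) T is a T-valued alternating k-linear map. *)
Definition is_form k (f : ('I_k -> V) -> T) : Prop :=
  multilinear f /\ alternating f.

(* Normalization of the wedge product: no factor 1/k!, so that interior
   multiplication is an antiderivation. *)
Definition wedge k (alpha : 'I_k -> 'Hom(V, R^o)) (v : 'I_k -> V) : R :=
  \det (\matrix_(p, q) (alpha p (v q) : R)).

(* omega^flat : v |-> i_v omega *)
Definition flat k (omega : ('I_k.+1 -> V) -> T) (v : V) : ('I_k -> V) -> T :=
  fun w => omega (fcons v w).

Definition form_ker k (omega : ('I_k.+1 -> V) -> T) : set V :=
  [set v | flat omega v = (fun=> 0)].

Definition annihilator L : set 'Hom(V, R^o) :=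
  [set alpha | forall v, v \in L -> alpha v = 0].

(* (/\^k A) (x) T as a subspace of the T-valued k-forms on V: the span of the
   (alpha_1 /\ ... /\ alpha_k) (x) t with all alpha_p in A and t in T (scalar
   coefficients are absorbed into t). *)
Definition ext_power_tensor k (A : set 'Hom(V, R^o)) :
    set (('I_k -> V) -> T) :=
  [set f | exists (m : nat) (alpha : 'I_m -> 'I_k -> 'Hom(V, R^o))
             (t : 'I_m -> T),
     (forall j p, A (alpha j p)) /\
     f = (fun v => \sum_(j < m) wedge (alpha j) v *: t j)].

Definition polylagrangian_subspace k N (omega : ('I_k.+1 -> V) -> T) L : Prop :=
  (\dim L + N = \dim {:V})%N /\
  flat omega @` [set v | v \in L] = ext_power_tensor (annihilator L).

Definition polylagrangian k N (omega : ('I_k.+1 -> V) -> T) : Prop :=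
  [/\ is_form omega,
      omega <> (fun=> 0)
    & exists L, polylagrangian_subspace N omega L].

Definition complementary W (K : set V) : Prop :=
  (forall v, exists w u, [/\ w \in W, K u & v = w + u]) /\
  (forall v, v \in W -> K v -> v = 0).

Definition increasing k N (i : {ffun 'I_k -> 'I_N}) : bool :=
  [forall p : 'I_k, forall q : 'I_k, (p < q)%N ==> (i p < i q)%N].

Definition multi_index k N := {i : {ffun 'I_k -> 'I_N} | increasing i}.

(* inl i labels e_i, and inr (a, I) labels e_a^I with I = (i_1 < ... < i_k). *)
Definition canonical_index k N n : finType :=
  ('I_N + 'I_n * multi_index k N)%type.

(* Totally antisymmetric extension of a family indexed by increasing
   multi-indices to all multi-indices: it takes I \o s to (-1)^s f I and
   multi-indices with a repetition to 0. For each i, at most one pair (s, I)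
   contributes to the sum. *)
Definition antisym_ext k N (f : multi_index k N -> 'Hom(V, R^o))
    (i : {ffun 'I_k -> 'I_N}) : 'Hom(V, R^o) :=
  \sum_(s : 'S_k) \sum_(I : multi_index k N | i == [ffun p => val I (s p)])
    (-1) ^+ s *: f I.

Definition canonical_form k N n (ehat : n.-tuple T)
    (D : canonical_index k N n -> 'Hom(V, R^o)) : ('I_k.+1 -> V) -> T :=
  fun v => (k`!%:R)^-1 *:
    \sum_(a < n) \sum_(i : {ffun 'I_k -> 'I_N})
      wedge (fcons (antisym_ext (fun I => D (inr (a, I))) i)
                   (fun p => D (inl (i p)))) v *: tnth ehat a.

(* D is the basis dual to B, extended by zero on K. *)
Definition dual_basis (J : finType) (K : set V) (B : J -> V)
    (D : J -> 'Hom(V, R^o)) : Prop :=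
  (forall x y, D x (B y) = (x == y)%:R) /\
  (forall x u, K u -> D x u = 0).

Definition canonical_basis k N n (omega : ('I_k.+1 -> V) -> T)
    (ehat : n.-tuple T) (B : canonical_index k N n -> V) : Prop :=
  exists (W : {vspace V}) (D : canonical_index k N n -> 'Hom(V, R^o)),
    [/\ complementary W (form_ker omega),
        basis_of W (codom B),
        dual_basis (form_ker omega) B D
      & omega = canonical_form ehat D].

End Forms.

(* Main.v *)
Require Import Defs.
From HB Require Import structures.
From mathcomp Require Import all_boot all_order all_algebra all_fingroup.
From mathcomp Require Import boolp classical_sets reals.

Set Implicit Arguments.
Unset Strict Implicit.
Unset Printing Implicit Defensive.

Import Order.TTheory GRing.Theory Num.Theory.
Local Open Scope ring_scope.

(* Idea. Choose a complement E of L with basis e_i, dual forms e^i. Elements of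
   (/\^k L^perp) (x) T are the alternating k-forms killed by L, and such a form
   is determined by its values on increasing tuples of the e_i. In particular L
   is isotropic, and there is u_i in L with flat(u_i) = i_{e_i} omega_E / (k+1),
   where omega_E is the restriction of omega to E extended by zero on L.
   Replacing e_i by e_i - u_i subtracts from omega_E exactly k+1 copies of
   omega_E / (k+1), because L is isotropic, so E becomes isotropic in the sense
   that omega vanishes on it. Then e_a^I in L with flat(e_a^I) = e^I (x) ehat_a,
   and the linear forms v |-> a-th coordinate of omega(v, e_I), are the rest of
   the canonical basis and of its dual: omega and the canonical form agree once
   an argument is in L, and both vanish on E. *)

(** * Prepending and replacing arguments *)

Lemma fcons0 (A : Type) k (x : A) (v : 'I_k -> A) : fcons x v ord0 = x.
Proof. by rewrite /fcons unlift_none. Qed.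

Lemma fconsS (A : Type) k (x : A) (v : 'I_k -> A) p :
  fcons x v (lift ord0 p) = v p.
Proof. by rewrite /fcons liftK. Qed.

Lemma fcons_eta (A : Type) k (v : 'I_k.+1 -> A) :
  fcons (v ord0) (fun p => v (lift ord0 p)) = v.
Proof.
by apply/funext => p; case: (unliftP ord0 p) => [q|] ->;
  rewrite ?fcons0 ?fconsS.
Qed.

Definition set_slot (A : Type) k (v : 'I_k -> A) p x : 'I_k -> A :=
  fun q => if q == p then x else v q.

Lemma set_slot_id (A : Type) k (v : 'I_k -> A) p : set_slot v p (v p) = v.
Proof. by apply/funext => q; rewrite /set_slot; case: eqP => [->|]. Qed.

(** * Multilinear maps, alternating forms and wedge products *)

Section AlternatingForms.
Context {R : realType} {V T : vectType R}.

Section Multilinear.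
Context {k : nat} {f : ('I_k -> V) -> T}.
Hypothesis mf : multilinear f.

Lemma multilinearB v p x y :
  f (set_slot v p (x - y)) = f (set_slot v p x) - f (set_slot v p y).
Proof.
have := mf p v (-1) y x; rewrite !scaleN1r [- y + x]addrC => ->.
by rewrite addrC.
Qed.

Lemma multilinear_slot0 v p : f (set_slot v p 0) = 0.
Proof. by rewrite -(subrr 0) multilinearB subrr. Qed.

Lemma multilinearD v p x y :
  f (set_slot v p (x + y)) = f (set_slot v p x) + f (set_slot v p y).
Proof. by have := mf p v 1 x y; rewrite !scale1r. Qed.

Lemma multilinearZ v p a x :
  f (set_slot v p (a *: x)) = a *: f (set_slot v p x).
Proof.
by have := mf p v a x 0; rewrite !addr0 => ->;
  rewrite [X in _ + X]multilinear_slot0 addr0.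
Qed.

Lemma multilinear_sum v p (I : finType) (c : I -> R) (x : I -> V) :
  f (set_slot v p (\sum_i c i *: x i)) = \sum_i c i *: f (set_slot v p (x i)).
Proof.
apply: (big_ind2 (fun a b => f (set_slot v p a) = b)).
- exact: multilinear_slot0.
- by move=> a b a' b' <- <-; rewrite multilinearD.
- by move=> i _; rewrite multilinearZ.
Qed.

Lemma multilinear_telescope v w :
  f v - f w = \sum_(j < k)
    f (fun q => if (q < j)%N then w q else if q == j then v j - w j else v q).
Proof.
(* [h m] takes its first [m] arguments from [w], so [h m] and [h m.+1] differ only in slot [m]. *)
pose h m := f (fun q => if (q < m)%N then w q else v q).
have -> : f v = h 0%N by congr f; apply/funext.
have -> : f w = h k by congr f; apply/funext => q; rewrite ltn_ord.
rewrite -opprB -telescope_sumr // -sumrN big_mkord; apply: eq_bigr => j _.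
rewrite opprB /h.
pose z (q : 'I_k) := if (q < j)%N then w q else v q.
transitivity (f (set_slot z j (v j)) - f (set_slot z j (w j))).
  congr (f _ - f _); apply/funext => q; rewrite /set_slot /z.
    by case: eqP => // ->; rewrite ltnn.
  by rewrite ltnS leq_eqVlt -val_eqE /=; case: eqP => //= /val_inj ->.
rewrite -multilinearB; congr f; apply/funext => q; rewrite /set_slot /z.
by case: eqP => // ->; rewrite ltnn.
Qed.

(** Slots are freed one at a time: by induction on [m], only those from [m] on need to lie in
    [S]. *)
Lemma slotwise_eq0 (S : V -> Prop) :
    (forall v p, (forall x, S x -> f (set_slot v p x) = 0) ->
       forall x, f (set_slot v p x) = 0) ->
    (forall v, (forall q, S (v q)) -> f v = 0) ->
  forall v, f v = 0.
Proof.
move=> genS f0 v.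
suff H m : forall v, (forall q : 'I_k, (m <= q)%N -> S (v q)) -> f v = 0.
  by apply: (H k) => q; rewrite leqNgt ltn_ord.
elim: m {v} => [|m IH] v Sv; first by apply: f0 => q; apply: Sv.
have [ltmk|lekm] := ltnP m k; last first.
  by apply: IH => q /(leq_trans lekm); rewrite leqNgt ltn_ord.
rewrite -(set_slot_id v (Ordinal ltmk)); apply: genS => x Sx.
apply: IH => q; rewrite leq_eqVlt /set_slot -val_eqE /= eq_sym.
by case: eqP => //= _; apply: Sv.
Qed.

End Multilinear.

(** Polarization: [g x y] is the form with [x] and [y] in slots [p] and [q], and
    [g (x + y) (x + y) = 0] is expanded. *)
Lemma form_tperm k (f : ('I_k -> V) -> T) v (p q : 'I_k) :
  is_form f -> p != q -> f (fun r => v (tperm p q r)) = - f v.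
Proof.
move=> [mf af] npq; apply/eqP; rewrite -addr_eq0; apply/eqP.
pose g x y := f (set_slot (set_slot v q y) p x).
have gE x : g x x = 0.
  apply: (af _ _ _ npq); rewrite /set_slot eqxx.
  by rewrite eq_sym (negbTE npq) eqxx.
have gDl x x' y : g (x + x') y = g x y + g x' y by exact: multilinearD.
have gDr x y y' : g x (y + y') = g x y + g x y'.
  have sw z : set_slot (set_slot v q z) p x = set_slot (set_slot v p x) q z.
    by apply/funext => r; rewrite /set_slot; case: eqP => // ->;
      rewrite (negbTE npq).
  by rewrite /g !sw; exact: multilinearD.
have := gE (v p + v q); rewrite gDl !gDr !gE add0r addr0 => <-.
rewrite addrC /g; congr (f _ + f _); apply/funext => r; rewrite /set_slot.
  by do 2![case: eqP => [->//|_]].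
by case: tpermP => [->|->|/eqP/negbTE-> /eqP/negbTE->];
  rewrite ?eqxx // eq_sym (negbTE npq).
Qed.

Lemma form_perm_eq0 k (f : ('I_k -> V) -> T) v (s : 'S_k) :
  is_form f -> f v = 0 -> f (fun r => v (s r)) = 0.
Proof.
move=> ff; case: (prod_tpermP s) => ts -> {s}.
elim: ts v => [|[p q] ts IH] v /=.
  by move=> _ fv; rewrite big_nil -[RHS]fv; congr f; apply/funext => r;
    rewrite perm1.
rewrite /dpair /= => /andP[npq dts] fv; rewrite big_cons.
pose w r := v ((\prod_(t <- ts) tperm t.1 t.2)%g r).
have -> : (fun r => v ((tperm p q * \prod_(t <- ts) tperm t.1 t.2)%g r)) =
    fun r => w (tperm p q r).
  by apply/funext => r; rewrite permM.
by rewrite form_tperm // IH ?oppr0.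
Qed.

(** A transposition, not a cyclic shift, brings slot [j] to the front, so the sign is the same for
    every [j] other than [ord0]. *)
Lemma form_slot k (f : ('I_k.+1 -> V) -> T) v (j : 'I_k.+1) :
  is_form f ->
  f v = (-1) ^+ (j != ord0) *:
    f (fcons (v j) (fun p => v (tperm ord0 j (lift ord0 p)))).
Proof.
move=> ff; pose w r := v (tperm ord0 j r).
have -> : fcons (v j) (fun p => v (tperm ord0 j (lift ord0 p))) = w.
  by rewrite -[RHS]fcons_eta /w tpermL.
rewrite /w; case: eqP => [->|/eqP nj]; last first.
  by rewrite form_tperm 1?eq_sym // scaleN1r opprK.
by rewrite scale1r; congr f; apply/funext => r; rewrite tperm1 perm1.
Qed.

Lemma tperm0_lift k (j : 'I_k.+1) (p : 'I_k) : tperm ord0 j (lift ord0 p) != j.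
Proof.
by rewrite -[X in _ != X](tpermL ord0 j) (inj_eq perm_inj) eq_sym neq_lift.
Qed.

Lemma form_slot_eq0 k (f : ('I_k.+1 -> V) -> T) v (j : 'I_k.+1) :
  is_form f -> flat f (v j) = (fun=> 0) -> f v = 0.
Proof.
move=> ff fj; rewrite (form_slot v j ff) -[f _]/(flat f (v j) _) fj.
by rewrite scaler0.
Qed.

(** Only arguments taken from [v] are tested, because the two contractions will be compared on
    tuples of basis vectors only. *)
Lemma form_slot_scale k (f : ('I_k.+1 -> V) -> T) (c : R) v (j : 'I_k.+1) x :
    is_form f ->
    (forall w : 'I_k -> V, (forall p, exists q, w p = v q) ->
      f (fcons x w) = c *: f (fcons (v j) w)) ->
  f (set_slot v j x) = c *: f v.
Proof.
move=> ff H; rewrite (form_slot (set_slot v j x) j ff) (form_slot v j ff).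
rewrite /set_slot eqxx scalerA mulrC -scalerA; congr (_ *: _).
rewrite -H; last by move=> p; exists (tperm ord0 j (lift ord0 p)).
by congr (f (fcons _ _)); apply/funext => p; rewrite (negbTE (tperm0_lift _ _)).
Qed.

Lemma flat_is_form k (f : ('I_k.+1 -> V) -> T) u :
  is_form f -> is_form (flat f u).
Proof.
move=> [mf af]; split=> [p v|v p q npq vpq]; last first.
  by apply: (af _ (lift ord0 p) (lift ord0 q));
    rewrite ?(inj_eq lift_inj) ?fconsS.
have E x : fcons u (fun q => if q == p then x else v q)
    = set_slot (fcons u v) (lift ord0 p) x.
  apply/funext => r; rewrite /set_slot; case: (unliftP ord0 r) => [q|] ->.
    by rewrite !fconsS (inj_eq lift_inj).
  by rewrite !fcons0 (negbTE (neq_lift _ _)).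
by move=> a x y; rewrite /flat !E; exact: mf.
Qed.

Lemma is_formB k (f g : ('I_k -> V) -> T) :
  is_form f -> is_form g -> is_form (fun v => f v - g v).
Proof.
move=> [mf af] [mg ag]; split=> [p v a x y|v p q npq vpq].
  by rewrite mf mg scalerBr opprD addrACA.
by rewrite (af v p q) // (ag v p q) // subrr.
Qed.

Lemma is_formZ k c (f : ('I_k -> V) -> T) :
  is_form f -> is_form (fun v => c *: f v).
Proof.
move=> [mf af]; split=> [p v a x y|v p q npq vpq].
  by rewrite mf scalerDr !scalerA mulrC.
by rewrite (af v p q) // scaler0.
Qed.

Lemma is_form_sum k (I : finType) (f : I -> ('I_k -> V) -> T) :
  (forall i, is_form (f i)) -> is_form (fun v => \sum_i f i v).
Proof.
move=> ff; split=> [p v a x y|v p q npq vpq].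
  rewrite scaler_sumr -big_split; apply: eq_bigr => i _.
  by case: (ff i) => + _; apply.
by rewrite big1 // => i _; case: (ff i) => _; apply; first exact: npq.
Qed.

Lemma wedge_tr k (alpha : 'I_k -> 'Hom(V, R^o)) v :
  wedge alpha v = \det (\matrix_(p, q) (alpha q (v p) : R)).
Proof.
by rewrite /wedge -det_tr; congr (\det _); apply/matrixP => p q; rewrite !mxE.
Qed.

Lemma wedge_is_form k (alpha : 'I_k -> 'Hom(V, R^o)) (t : T) :
  is_form (fun v => wedge alpha v *: t).
Proof.
split=> [p v a x y|v p q npq vpq]; last first.
  rewrite wedge_tr (determinant_alternate npq) ?scale0r // => r.
  by rewrite !mxE vpq.
rewrite scalerA -scalerDl; congr (_ *: t).
rewrite !wedge_tr -(mul1r (\det (\matrix_(i, j) alpha j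
  (if i == p then y else v i)))).
apply: (@determinant_multilinear _ _ _ _ _ p).
- by apply/rowP => q; rewrite !mxE eqxx linearP /= mul1r.
- by apply/matrixP => q r; rewrite !mxE eq_sym (negbTE (neq_lift _ _)).
- by apply/matrixP => q r; rewrite !mxE eq_sym (negbTE (neq_lift _ _)).
Qed.

Lemma wedge_eq0 k (alpha : 'I_k -> 'Hom(V, R^o)) v p :
  (forall q, alpha q (v p) = 0) -> wedge alpha v = 0.
Proof.
move=> a0; rewrite /wedge (expand_det_col _ p) big1 // => q _.
by rewrite mxE a0 mul0r.
Qed.

Lemma wedge_perm k (alpha : 'I_k -> 'Hom(V, R^o)) (s : 'S_k) v :
  wedge (fun p => alpha (s p)) v = (-1) ^+ s * wedge alpha v.
Proof.
rewrite /wedge -det_perm -det_mulmx -row_permE; congr (\det _).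
by apply/matrixP => p q; rewrite !mxE.
Qed.

(** Laplace expansion along the first column, which vanishes below the corner. *)
Lemma wedge_fcons k (a : 'Hom(V, R^o)) (alpha : 'I_k -> 'Hom(V, R^o)) x v :
  (forall q, alpha q x = 0) ->
  wedge (fcons a alpha) (fcons x v) = a x * wedge alpha v.
Proof.
move=> a0; rewrite /wedge (expand_det_col _ ord0) big_ord_recl big1 ?addr0.
  rewrite !mxE !fcons0 /cofactor /= expr0 mul1r; congr (_ * \det _).
  by apply/matrixP => p q; rewrite !mxE !fconsS.
by move=> i _; rewrite mxE fconsS fcons0 a0 mul0r.
Qed.

Lemma wedge_fcons_row k (a : 'Hom(V, R^o)) (alpha : 'I_k -> 'Hom(V, R^o)) x v :
  (forall q, a (v q) = 0) ->
  wedge (fcons a alpha) (fcons x v) = a x * wedge alpha v.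
Proof.
move=> a0; rewrite /wedge (expand_det_row _ ord0) big_ord_recl big1 ?addr0.
  rewrite !mxE !fcons0 /cofactor /= expr0 mul1r; congr (_ * \det _).
  by apply/matrixP => p q; rewrite !mxE !fconsS.
by move=> i _; rewrite mxE fconsS fcons0 a0 mul0r.
Qed.

End AlternatingForms.

(** * Increasing multi-indices *)

Section MultiIndices.
Context {k N : nat}.

Lemma multi_index_mono (I : multi_index k N) (p q : 'I_k) :
  (p < q)%N -> (val I p < val I q)%N.
Proof. by move: (valP I) => /forallP/(_ p)/forallP/(_ q)/implyP; apply. Qed.

Lemma multi_index_inj (I : multi_index k N) : injective (val I).
Proof.
move=> p q Ipq; apply: val_inj => /=.
by case: (ltngtP p q) => // /(multi_index_mono I); rewrite Ipq ltnn.
Qed.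

Lemma multi_index_sort (i : 'I_k -> 'I_N) : injective i ->
  exists (I : multi_index k N) (s : 'S_k), forall p, i p = val I (s p).
Proof.
move=> inji; pose t := [tuple i p | p < k].
pose r : rel 'I_N := relpre val leq.
have rtot : total r by move=> x y; exact: leq_total.
pose u := sort_tuple r t.
have uu : uniq u by rewrite sort_uniq map_inj_uniq ?enum_uniq.
have incr : increasing [ffun p => tnth u p].
  apply/forallP => p; apply/forallP => q; apply/implyP => ltpq; rewrite !ffunE.
  (* [i p] serves as the default value of [nth], for which ['I_N] must be inhabited. *)
  rewrite ltn_neqAle; have x0 := i p.
  rewrite !(tnth_nth x0) val_eqE nth_uniq ?size_tuple // neq_ltn ltpq /=.
  have rtr : transitive r by move=> x y z; exact: leq_trans.
  by apply: (sorted_ltn_nth rtr x0 (sort_sorted rtot t));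
    rewrite ?inE ?size_sort ?size_tuple.
have /tuple_permP[s st] : perm_eq t u by rewrite perm_sym perm_sort.
exists (exist (fun I : {ffun _ -> _} => increasing I) _ incr), s => p;
  rewrite ffunE.
have : t = [tuple tnth u (s p) | p < k] by apply: val_inj; exact: st.
by move/(congr1 (fun x => tnth x p)); rewrite !tnth_mktuple.
Qed.

(** An inclusion between value sets of the same size [k] is an equality, and a strictly increasing
    list is determined by its set of values. *)
Lemma multi_index_sub_eq (I J : multi_index k N) :
  (forall p, exists q, val I p = val J q) -> I = J.
Proof.
move=> IJ; pose c (K : multi_index k N) := codom (val K).
have cu K : uniq (c K) by rewrite map_inj_uniq ?enum_uniq //;
  exact: multi_index_inj.
have srt K : sorted (relpre val ltn) (c K).
  apply: (homo_sorted (e := relpre val ltn)) => [p q|].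
    exact: multi_index_mono.
  by rewrite -sorted_map val_enum_ord iota_ltn_sorted.
have sub : {subset c I <= c J}.
  by move=> x /codomP[p ->]; have [q ->] := IJ p; exact: codom_f.
have [_ eqc] := uniq_min_size (cu I) sub
  (eq_leq (etrans (size_codom _) (esym (size_codom _)))).
have : c I = c J.
  apply: (irr_sorted_eq (leT := relpre val ltn)) => // [x y z|x] /=.
    exact: ltn_trans.
  exact: ltnn.
move=> /eq_in_map cIJ; apply: val_inj; apply/ffunP => p.
by apply: cIJ; rewrite mem_enum.
Qed.

End MultiIndices.

(** If [I] and [J] differ, some value of [I] is missing from [J], and its row in the matrix is
    zero. *)
Lemma wedge_dual (R : realType) (V : vectType R) k N (e : 'I_N -> V)
    (eps : 'I_N -> 'Hom(V, R^o)) (I J : multi_index k N) :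
  (forall i j, eps i (e j) = (i == j)%:R) ->
  wedge (fun p => eps (val I p)) (fun p => e (val J p)) = (I == J)%:R.
Proof.
move=> dual; have [<-|nIJ] := eqVneq I J.
  rewrite -[RHS](det1 R k); congr (\det _); apply/matrixP => p q.
  by rewrite !mxE dual (inj_eq (@multi_index_inj _ _ I)).
case: (pselect (forall p, exists q, val I p = val J q)) =>
  [/multi_index_sub_eq|].
  by move/eqP: nIJ.
move/existsNP => [p /forallNP pJ].
rewrite /wedge (expand_det_row _ p) big1 // => q _.
by rewrite mxE dual; case: eqP => [/pJ//|_]; rewrite mul0r.
Qed.

(** * Contractions of the canonical form *)

Section CanonicalForm.
Context {R : realType} {V T : vectType R} {k N n : nat}.
Variables (ehat : n.-tuple T) (D : canonical_index k N n -> 'Hom(V, R^o)).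

Lemma canonical_form_is_form : is_form (canonical_form ehat D).
Proof.
apply: is_formZ; apply: is_form_sum => a; apply: is_form_sum => i.
exact: wedge_is_form.
Qed.

(** The sign in [antisym_ext] cancels the sign of permuting the wedge factors, so all permutations
    contribute equally and their number cancels the normalizing factorial. *)
Lemma canonical_form_fcons u w : (forall i, D (inl i) u = 0) ->
  canonical_form ehat D (fcons u w) =
  \sum_(a < n) \sum_(I : multi_index k N)
    (D (inr (a, I)) u * wedge (fun p => D (inl (val I p))) w) *: tnth ehat a.
Proof.
move=> Du; rewrite /canonical_form scaler_sumr; apply: eq_bigr => a _.
rewrite -!scaler_suml scalerA; congr (_ *: _).
pose W (i : 'I_k -> 'I_N) := wedge (fun p => D (inl (i p))) w.
transitivity ((k`!%:R)^-1 * \sum_(s : 'S_k) \sum_(I : multi_index k N)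
    D (inr (a, I)) u * W (val I)).
  congr (_ * _).
  under eq_bigr => i _.
    rewrite wedge_fcons // /antisym_ext sum_lfunE mulr_suml.
    under eq_bigr => s _.
      rewrite sum_lfunE mulr_suml big_mkcond.
      over.
    over.
  rewrite exchange_big; apply: eq_bigr => s _.
  rewrite exchange_big; apply: eq_bigr => I _.
  (* For given [s] and [I], a single multi-index [i] contributes. *)
  rewrite -big_mkcond (big_pred1 [ffun p => val I (s p)]) //=.
  rewrite scale_lfunE /=.
  have -> : wedge (fun p => D (inl ([ffun p0 => val I (s p0)] p))) w =
      (-1) ^+ s * W (val I).
    rewrite -wedge_perm; congr (wedge _ w); apply/funext => p; by rewrite ffunE.
  by rewrite -[_ *: _]/(_ * _) mulrACA -signr_addb addbb mul1r.
rewrite sumr_const card_Sn -[X in _ * X]mulr_natl mulrA mulVf ?mul1r //.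
by rewrite pnatr_eq0 -lt0n fact_gt0.
Qed.

Lemma canonical_form_eq0 v :
  (forall a I p, D (inr (a, I)) (v p) = 0) -> canonical_form ehat D v = 0.
Proof.
move=> Dv; rewrite /canonical_form big1 ?scaler0 // => a _.
rewrite big1 // => i _; rewrite /wedge (expand_det_row _ ord0).
rewrite big1 ?scale0r // => q _; rewrite mxE fcons0 /antisym_ext.
rewrite sum_lfunE big1 ?mul0r // => s _.
by rewrite sum_lfunE big1 // => I _; rewrite scale_lfunE /= Dv scaler0.
Qed.

End CanonicalForm.

(** * Complements of [L] and forms killed by [L] *)

Section Transversal.
Context {R : realType} {V T : vectType R} {N : nat}.
Variables (L : {vspace V}) (e : 'I_N -> V) (eps : 'I_N -> 'Hom(V, R^o)).

(** Encodes a basis [e] of a complement of [L], with its dual basis extended by zero on [L]. *)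
Definition transversal : Prop :=
  [/\ forall i u, u \in L -> eps i u = 0,
      forall i j, eps i (e j) = (i == j)%:R
    & forall v, v - \sum_i eps i v *: e i \in L].

Hypothesis tr : transversal.

(** A description of (/\^k L^perp) (x) T without decomposable tensors; [ext_power_tensorE] shows
    that the two agree. *)
Definition semibasic k (f : ('I_k -> V) -> T) : Prop :=
  is_form f /\ forall v p, v p \in L -> f v = 0.

(** A repeated index gives zero by alternation, and an injective [i] is a permuted increasing
    one. *)
Lemma form_basis_eq0 k (f : ('I_k -> V) -> T) (i : 'I_k -> 'I_N) : is_form f ->
    (forall I : multi_index k N, f (fun p => e (val I p)) = 0) ->
  f (fun p => e (i p)) = 0.
Proof.
move=> ff fe; case: (pselect (injective i)) => [inji|ninj].
  have [I [s iE]] := multi_index_sort inji.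
  have -> : (fun p => e (i p)) = fun p => e (val I (s p)).
    by apply/funext => p; rewrite iE.
  exact: (form_perm_eq0 (v := fun p => e (val I p))).
move/existsNP: ninj => [p /existsNP[q /not_implyP[ipq /eqP npq]]].
by apply: (ff.2 _ p q) => //; rewrite ipq.
Qed.

(** Since [L] and the [e i] span [V], arguments may be taken among them, and those in [L] give
    zero. *)
Lemma semibasic_eq0 k (f : ('I_k -> V) -> T) : semibasic f ->
  (forall I : multi_index k N, f (fun p => e (val I p)) = 0) ->
  forall v, f v = 0.
Proof.
move=> [ff fL] fe; have [mf _] := ff; case: tr => _ _ trL.
apply: (slotwise_eq0 (S := fun x => x \in L \/ exists i, x = e i)).
  move=> v p fS x; rewrite -[x](subrK (\sum_i eps i x *: e i)).
  rewrite multilinearD // multilinear_sum // [X in _ + X]big1 => [|i _].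
    by rewrite addr0; apply: fS; left.
  by rewrite (fS (e i)) ?scaler0 //; right; exists i.
move=> v vS; case: (pselect (exists p, v p \in L)) => [[p /fL]//|/forallNP vL].
have {}vS p : exists i, v p = e i by case: (vS p) => // /vL.
have {vS}[i vE] := choice vS.
have -> : v = fun p => e (i p) by apply/funext.
exact: form_basis_eq0.
Qed.

Lemma wedge_semibasic k (alpha : 'I_k -> 'Hom(V, R^o)) (t : T) :
  (forall p, annihilator L (alpha p)) ->
  semibasic (fun v => wedge alpha v *: t).
Proof.
move=> aL; split=> [|v p vp]; first exact: wedge_is_form.
by rewrite (@wedge_eq0 _ _ _ _ _ p) ?scale0r // => q; exact: aL.
Qed.

(** For a form [f], this is its restriction to the span of the [e i], extended by zero on [L]. *)
Definition semibasic_part k (f : ('I_k -> V) -> T) : ('I_k -> V) -> T :=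
  fun v => \sum_(I : multi_index k N)
    wedge (fun p => eps (val I p)) v *: f (fun p => e (val I p)).

Lemma semibasic_part_semibasic k (f : ('I_k -> V) -> T) :
  semibasic (semibasic_part f).
Proof.
have [epsL _ _] := tr.
have sw (I : multi_index k N) := @wedge_semibasic k (fun p => eps (val I p))
  (f (fun p => e (val I p))) (fun p => epsL (val I p)).
split=> [|v p vp]; first by apply: is_form_sum => I; exact: (sw I).1.
by rewrite /semibasic_part big1 // => I _; exact: (sw I).2 v p vp.
Qed.

Lemma semibasic_part_increasing k (f : ('I_k -> V) -> T) (I : multi_index k N) :
  semibasic_part f (fun p => e (val I p)) = f (fun p => e (val I p)).
Proof.
have [_ dual _] := tr.
rewrite /semibasic_part (bigD1 I) //= wedge_dual // eqxx scale1r big1 ?addr0 //.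
by move=> J nJI; rewrite wedge_dual // (negbTE nJI) scale0r.
Qed.

Lemma semibasic_part_basis k (f : ('I_k -> V) -> T) (i : 'I_k -> 'I_N) :
  is_form f -> semibasic_part f (fun p => e (i p)) = f (fun p => e (i p)).
Proof.
move=> ff; apply/eqP; rewrite -subr_eq0; apply/eqP.
apply: (@form_basis_eq0 _ (fun v => semibasic_part f v - f v)).
  by apply: is_formB => //; exact: (semibasic_part_semibasic f).1.
by move=> I; rewrite semibasic_part_increasing subrr.
Qed.

Lemma semibasic_expand k (f : ('I_k -> V) -> T) :
  semibasic f -> f = semibasic_part f.
Proof.
move=> [ff fL]; have [gf gL] := semibasic_part_semibasic f.
apply/funext => v; apply/eqP; rewrite -subr_eq0; apply/eqP.
apply: (@semibasic_eq0 _ (fun v => f v - semibasic_part f v)) => [|I].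
  split=> [|w p wp]; first exact: is_formB.
  by rewrite (fL _ _ wp) (gL _ _ wp) subrr.
by rewrite semibasic_part_increasing subrr.
Qed.

Lemma ext_power_tensorE k (f : ('I_k -> V) -> T) :
  ext_power_tensor (annihilator L) f <-> semibasic f.
Proof.
split=> [[m [alpha [t [aL ->]]]]|sf].
  have sw j := wedge_semibasic (t j) (aL j).
  split=> [|v p vp]; first by apply: is_form_sum => j; exact: (sw j).1.
  by rewrite big1 // => j _; exact: (sw j).2 v p vp.
(* [ext_power_tensor] asks for a family indexed by an ordinal, so the multi-indices are
   enumerated. *)
pose I (j : 'I_#|{: multi_index k N}|) : multi_index k N := enum_val j.
exists #|{: multi_index k N}|, (fun j p => eps (val (I j) p)),
  (fun j => f (fun p => e (val (I j) p))).
have [epsL _ _] := tr.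
split=> [j p u|]; first exact: epsL.
apply/funext => v; rewrite {1}(semibasic_expand sf) /semibasic_part.
by rewrite (reindex I) //; exact/onW_bij/enum_val_bij.
Qed.

End Transversal.

Lemma transversal_exists (R : realType) (V : vectType R) N (L : {vspace V}) :
  (\dim L + N = \dim {:V})%N ->
  exists (e : 'I_N -> V) (eps : 'I_N -> 'Hom(V, R^o)), transversal L e eps.
Proof.
move=> dimL; have -> : N = \dim (L^C) by rewrite dimv_compl -dimL addKn.
have ELC : ((L^C) :&: L = 0)%VS by rewrite capvC capv_compl.
set E := (L^C)%VS in ELC *.
have bE := vbasisP E.
exists (fun i => (vbasis E)`_i).
(* [daddv_pi E L] is the projection onto [E] along [L]. *)
exists (fun i => (linfun (coord (vbasis E) i : V -> R^o) \o daddv_pi E L)%VF).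
have EL v : v = daddv_pi E L v + daddv_pi L E v.
  by rewrite daddv_pi_add // addvC addv_complf memvf.
have piL u : u \in L -> daddv_pi E L u = 0.
  move=> uL; have := EL u; rewrite (daddv_pi_id (U := L)) 1?capvC //.
  by move/eqP; rewrite -subr_eq subrr eq_sym => /eqP.
split=> [i u uL|i j|v].
- by rewrite comp_lfunE piL // linear0.
- rewrite comp_lfunE lfunE /= daddv_pi_id ?coord_free ?(basis_free bE) //
    1?eq_sym //.
  by apply: vbasis_mem; rewrite mem_nth ?size_tuple.
- have -> : \sum_i (linfun (coord (vbasis E) i : V -> R^o) \o daddv_pi E L)%VF
    v *: (vbasis E)`_i = daddv_pi E L v.
    rewrite [RHS](coord_basis bE) ?memv_pi //; apply: eq_bigr => i _.
    by rewrite comp_lfunE lfunE.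
  by rewrite [X in X - _]EL addrC addKr memv_pi.
Qed.

(** * Families of vectors with a dual family of linear forms *)

Section DualFamily.
Context {R : realType} {V : vectType R} {J : finType}.
Variables (B : J -> V) (D : J -> 'Hom(V, R^o)).
Hypothesis DB : forall x y, D x (B y) = (x == y)%:R.

Lemma dual_coord y (c : J -> R) : D y (\sum_x c x *: B x) = c y.
Proof.
rewrite linear_sum (bigD1 y) //= linearZ /= DB eqxx big1 ?addr0 => [|x nxy].
  by rewrite -[_ *: _]/(_ * _) mulr1.
by rewrite linearZ /= DB eq_sym (negbTE nxy) scaler0.
Qed.

Lemma sum_codom (c : 'I_#|J| -> R) :
  \sum_i c i *: (codom_tuple B)`_i = \sum_x c (enum_rank x) *: B x.
Proof.
rewrite (reindex enum_rank); last exact/onW_bij/enum_rank_bij.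
by apply: eq_bigr => x _; rewrite nth_codom enum_rankK.
Qed.

Lemma dual_free : free (codom B).
Proof.
apply/(@freeP _ _ _ (codom_tuple B)) => c; rewrite sum_codom => c0 i.
by rewrite -(enum_valK i) -(dual_coord _ (fun x => c (enum_rank x))) c0 linear0.
Qed.

Lemma dual_span v : v \in <<codom B>>%VS -> v = \sum_x D x v *: B x.
Proof.
move=> /(@coord_span _ _ _ (codom_tuple B)); rewrite sum_codom => vE.
rewrite {1}vE; apply: eq_bigr => x _; congr (_ *: _).
by rewrite [in RHS]vE dual_coord.
Qed.

End DualFamily.

(** * Isotropy of [L] and of a corrected complement *)

Section Polylagrangian.
Context {R : realType} {V T : vectType R} {k N : nat}.
Variables (omega : ('I_k.+1 -> V) -> T) (L : {vspace V}).
Hypothesis formw : is_form omega.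
Hypothesis flatL :
  (flat omega @` [set v | v \in L])%classic = ext_power_tensor (annihilator L).

Lemma flat_image f :
  ext_power_tensor (annihilator L) f -> exists2 u, u \in L & flat omega u = f.
Proof. by rewrite -flatL => -[u uL uf]; exists u. Qed.

Section WithTransversal.
Variables (e : 'I_N -> V) (eps : 'I_N -> 'Hom(V, R^o)).
Hypothesis tr : transversal L e eps.

Lemma flat_semibasic u : u \in L -> semibasic L (flat omega u).
Proof.
by move=> uL; apply/(ext_power_tensorE tr); rewrite -flatL; exists u.
Qed.

(** Contracting with [v p] leaves a semibasic form, which still has [v q] among its arguments. *)
Lemma polylagrangian_isotropic v p q :
  p != q -> v p \in L -> v q \in L -> omega v = 0.
Proof.
move=> npq vp vq; rewrite (form_slot v p formw).
case: (unliftP ord0 (tperm ord0 p q)) => [r rE|].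
  rewrite -[omega _]/(flat omega (v p) _) ((flat_semibasic vp).2 _ r)
    ?scaler0 //.
  by rewrite -rE tpermK.
move/(congr1 (tperm ord0 p)); rewrite tpermK tpermL => qp.
by rewrite qp eqxx in npq.
Qed.

(** In the telescoping sum, the term of a slot other than [j] has two arguments in [L], and the term
    of [j] has a zero argument. *)
Lemma omega_congr_L v w j :
  v j = w j -> v j \in L -> (forall q, v q - w q \in L) -> omega v = omega w.
Proof.
move=> vwj vj vw; apply/eqP; rewrite -subr_eq0 (multilinear_telescope formw.1).
rewrite big1 // => m _; have [jm|njm] := eqVneq m j.
  rewrite -[RHS](multilinear_slot0 formw.1
    (fun q : 'I_k.+1 => if (q < m)%N then w q else v q) m).
  congr omega; apply/funext => q; rewrite /set_slot; case: eqP => [->|//].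
  by rewrite ltnn jm vwj subrr.
apply: (polylagrangian_isotropic njm); first by rewrite ltnn eqxx.
by rewrite eq_sym (negbTE njm) -vwj if_same.
Qed.

Lemma adapted_transversal : exists e', transversal L e' eps /\
  forall i : 'I_k.+1 -> 'I_N, omega (fun p => e' (i p)) = 0.
Proof.
have [epsL dual trL] := tr.
(* One share for each of the k+1 slots in which a correction will be made. *)
pose c : R := (k.+1%:R)^-1.
have uP i : exists u, u \in L /\ flat omega u =
    (fun v => c *: semibasic_part e eps (flat omega (e i)) v).
  have /flat_image[u uL uE] : ext_power_tensor (annihilator L)
      (fun v => c *: semibasic_part e eps (flat omega (e i)) v).
    apply/(ext_power_tensorE tr).
    have [gf gL] := semibasic_part_semibasic tr (flat omega (e i)).
    split=> [|v p vp]; first exact: is_formZ.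
    by rewrite (gL _ _ vp) scaler0.
  by exists u.
have {uP}[u uP] := choice uP.
have uL i : u i \in L by case: (uP i).
exists (fun i => e i - u i); split.
  split=> // [i j|v]; first by rewrite linearB /= dual epsL // subr0.
  under eq_bigr do rewrite scalerBr.
  rewrite sumrB opprB addrA addrAC; apply: rpredD => //.
  by apply: rpred_sum => i _; apply: rpredZ.
move=> i; pose v p := e (i p).
(* On tuples of the [e i], contraction with [u (i j)] is [c] times contraction with [e (i j)]. *)
have slot j : omega (set_slot v j (u (i j))) = c *: omega v.
  apply: form_slot_scale => // w wv.
  have {wv}[s wE] := choice wv.
  have -> : w = fun p => e (i (s p)) by apply/funext.
  rewrite -[omega _]/(flat omega (u (i j)) _) (uP (i j)).2.
  by rewrite (semibasic_part_basis tr) //; exact: flat_is_form.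
rewrite -[LHS](subKr (omega v)); apply/eqP; rewrite subr_eq0 eq_sym; apply/eqP.
rewrite (multilinear_telescope formw.1).
transitivity (\sum_(j < k.+1) c *: omega v).
  (* Slot [j] of this term holds [u (i j)], which is in [L], so the other arguments matter only
     modulo [L] and can be taken from [v]. *)
  apply: eq_bigr => j _; rewrite -(slot j).
  apply: (@omega_congr_L _ _ j); rewrite /set_slot ?ltnn ?eqxx /v ?subKr //.
  move=> q; case: eqP => [->|nqj]; first by rewrite ltnn subrr mem0v.
  case: ifP => _; last by rewrite subrr mem0v.
  by rewrite addrAC subrr add0r rpredN.
rewrite sumr_const card_ord -scaler_nat scalerA mulfV ?scale1r //.
by rewrite pnatr_eq0.
Qed.

End WithTransversal.
End Polylagrangian.

(** * The kernel of [omega] *)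

Section Kernel.
Context {R : realType} {V T : vectType R} {k N : nat}.
Variables (omega : ('I_k.+2 -> V) -> T) (L : {vspace V}).
Variables (e : 'I_N -> V) (eps : 'I_N -> 'Hom(V, R^o)).
Hypothesis formw : is_form omega.
Hypothesis flatL :
  (flat omega @` [set v | v \in L])%classic = ext_power_tensor (annihilator L).
Hypothesis tr : transversal L e eps.
Hypothesis omega_e : forall i : 'I_k.+2 -> 'I_N, omega (fun p => e (i p)) = 0.
Hypothesis omega_neq0 : omega <> (fun=> 0).

(* If eps i v <> 0, complete eps i to a wedge product of k+1 of the eps_j. It is
   in the image of L under flat up to a coefficient in T, hence killed by v. *)
Lemma form_ker_annihilated v i : form_ker omega v -> eps i v = 0.
Proof.
move=> kv; have [epsL dual _] := tr.
(* Otherwise all of [L] would lie in the kernel, so [omega] would be semibasic, hence zero as it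
   vanishes on the [e i]. *)
have [u [uL [J nz]]] : exists u, u \in L /\
    exists J : multi_index k.+1 N, flat omega u (fun p => e (val J p)) <> 0.
  apply/not_existsP => H; apply: omega_neq0; apply/funext.
  apply: (semibasic_eq0 tr) => [|I]; last exact: omega_e.
  split=> // w p wp; apply: (form_slot_eq0 (j := p)) => //.
  apply/funext; apply: (semibasic_eq0 tr (flat_semibasic flatL tr wp)) => J.
  by apply: contra_notP (H (w p)) => nz; split=> //; exists J.
(* The position dropped from [J] to make room for [i]: that of [i] if it occurs, else the first. *)
have [p Jp] : exists p, forall q, val J (lift p q) <> i.
  case: (pselect (exists p, val J p = i)) => [[p <-]|/forallNP nJ].
    exists p => q /multi_index_inj/eqP; apply/negP.
    by rewrite eq_sym neq_lift.
  by exists ord0 => q; apply: nJ.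
set t := flat omega u _ in nz.
pose w q := e (val J (lift p q)).
have [u' u'L u'E] : exists2 u', u' \in L & flat omega u' = fun x =>
    wedge (fcons (eps i) (fun q => eps (val J (lift p q)))) x *: t.
  apply: (flat_image flatL); apply/(ext_power_tensorE tr).
  apply: wedge_semibasic => r u0 u0L.
  by case: (unliftP ord0 r) => [q|] ->; rewrite ?fcons0 ?fconsS epsL.
(* The kernel vector [v] sits in the second slot of [omega]. *)
have : flat omega u' (fcons v w) = 0.
  apply: (form_slot_eq0 (j := lift ord0 ord0)) => //.
  by rewrite fconsS fcons0.
(* [eps i] kills every entry of [w], so the value is [eps i v] times the nonzero vector [t]. *)
rewrite u'E wedge_fcons_row => [/eqP|q]; last first.
  by rewrite dual; case: eqP => // /esym/Jp.
have -> : wedge (fun q => eps (val J (lift p q))) w = 1.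
  rewrite -[RHS](det1 R k); congr (\det _); apply/matrixP => a b.
  rewrite !mxE dual (inj_eq (@multi_index_inj _ _ J)).
  by rewrite (inj_eq lift_inj).
by rewrite mulr1 scaler_eq0 => /orP[/eqP//|/eqP].
Qed.

End Kernel.

(** * Construction of the canonical basis and its dual *)

Lemma flat_linfun (R : realType) (V T : vectType R) k
    (f : ('I_k.+1 -> V) -> T) w : is_form f ->
  exists h : 'Hom(V, T), forall v, h v = f (fcons v w).
Proof.
move=> [mf _]; pose g v := f (fcons v w).
have lg : linear g.
  have gE x : g x = f (set_slot (fcons 0 w) ord0 x).
    congr f; apply/funext => r; rewrite /set_slot.
    by case: (unliftP ord0 r) => [q|] ->; rewrite ?fcons0 ?fconsS.
  by move=> a x y; rewrite !gE multilinearD // multilinearZ.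
pose G : {linear V -> T} := HB.pack g (GRing.isLinear.Build _ _ _ _ g lg).
by exists (linfun G) => v; rewrite lfunE.
Qed.

Theorem theorem3 (R : realType) (V T : vectType R) (k N n : nat)
    (omega : ('I_k.+1 -> V) -> T) (ehat : n.-tuple T) :
  (1 <= k)%N ->
  polylagrangian N omega ->
  basis_of {:T} ehat ->
  exists B : canonical_index k N n -> V, canonical_basis omega ehat B.
Proof.
(* With [k] positive, [omega] has degree at least two, as in the study of its kernel. *)
case: k omega => // k omega _ [formw omega_neq0 [L [dimL flatL]]] bT.
have [e0 [eps tr0]] := transversal_exists dimL.
have [e [tr omega_e]] := adapted_transversal formw flatL tr0.
have [epsL dual trL] := tr.
(* [h I] is the contraction v |-> omega(v, e_I), bundled as a linear map so that [D] can use its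
   coordinates. *)
have [h hE] := choice (fun I : multi_index k.+1 N =>
  flat_linfun (fun p => e (val I p)) formw).
pose D (x : canonical_index k.+1 N n) : 'Hom(V, R^o) := match x with
  | inl i => eps i
  | inr (a, J) => (linfun (coord ehat a : T -> R^o) \o h J)%VF
  end.
have DE a I v : D (inr (a, I)) v =
    coord ehat a (omega (fcons v (fun p => e (val I p)))).
  by rewrite comp_lfunE lfunE /= hE.
(* For [x = (a, I)], the vector is e_a^I, whose contraction is e^I (x) ehat_a. *)
have uP (x : 'I_n * multi_index k.+1 N) : exists u, u \in L /\ flat omega u =
    fun v => wedge (fun p => eps (val x.2 p)) v *: tnth ehat x.1.
  have [|u uL uE] := flat_image flatL (f := fun v =>
      wedge (fun p => eps (val x.2 p)) v *: tnth ehat x.1).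
    by apply/(ext_power_tensorE tr); apply: wedge_semibasic => p; exact: epsL.
  by exists u.
have {uP}[u uP] := choice uP.
pose B (x : canonical_index k.+1 N n) : V := match x with
  | inl i => e i | inr y => u y end.
have DB x y : D x (B y) = (x == y)%:R.
  case: x y => [i|[a I]] [j|[b J]]; rewrite ?DE /=.
  - exact: dual.
  - by rewrite epsL // (uP _).1.
  (* This entry is a coordinate of a value of [omega] on the [e i] alone. *)
  - have -> : fcons (e j) (fun p => e (val I p)) =
        fun p => e (fcons j (val I) p).
      apply/funext => r.
      by case: (unliftP ord0 r) => [q|] ->; rewrite ?fcons0 ?fconsS.
    by rewrite omega_e linear0.
  - rewrite -[omega _]/(flat omega (u (b, J)) _) (uP _).2 /= wedge_dual //.
    rewrite linearZ /= (tnth_nth 0) coord_free ?(basis_free bT) //.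
    rewrite -natrM mulnb andbC; congr (nat_of_bool _)%:R.
    by rewrite [J == I]eq_sym [b == a]eq_sym.
have Dker x v : form_ker omega v -> D x v = 0.
  case: x => [i|[a I]] kv.
    exact: (form_ker_annihilated formw flatL tr omega_e omega_neq0 i kv).
  by rewrite DE -[omega _]/(flat omega v _) kv linear0.
(* The right-hand side is, up to the order of the sums, the contraction of the canonical form given
   by [canonical_form_fcons]. *)
have flatE v w : v \in L -> flat omega v w =
    \sum_(I : multi_index k.+1 N) \sum_(a < n)
      (D (inr (a, I)) v * wedge (fun p => D (inl (val I p))) w) *: tnth ehat a.
  move=> vL; rewrite (semibasic_expand tr (flat_semibasic flatL tr vL)).
  apply: eq_bigr => I _; rewrite [X in _ *: X](coord_basis bT) ?memvf //.
  rewrite scaler_sumr; apply: eq_bigr => a _.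
  by rewrite scalerA mulrC DE (tnth_nth 0).
exists B, <<codom B>>%VS, D; split.
- split=> [v|v vW kv]; last first.
    by rewrite (dual_span DB vW) big1 // => x _; rewrite Dker ?scale0r.
  pose w := \sum_x D x v *: B x.
  have Dr x : D x (v - w) = 0 by rewrite linearB /= dual_coord // subrr.
  exists w, (v - w); split; last by rewrite addrC subrK.
    by apply: rpred_sum => x _; apply: rpredZ; apply: memv_span; exact: codom_f.
  (* The [eps i] kill the remainder, so it lies in [L]; since the other forms [D] kill it too,
     [flatE] puts it in the kernel. *)
  have rL : v - w \in L.
    rewrite -[v - w]subr0; have := trL (v - w).
    by rewrite big1 // => i _; rewrite [eps i _](Dr (inl i)) scale0r.
  apply/funext => x; rewrite flatE // big1 // => I _.
  by rewrite big1 // => a _; rewrite Dr mul0r scale0r.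
- by rewrite /basis_of eqxx (dual_free DB).
- by [].
- have formD := canonical_form_is_form ehat D.
  apply/funext => v; apply/eqP; rewrite -subr_eq0; apply/eqP; move: v.
  have formB := is_formB formw formD.
  (* By [flatE] the difference of the two forms is semibasic, so comparing them on the [e i], where
     both vanish, suffices. *)
  apply: (semibasic_eq0 tr) => [|I].
    split=> // v p vp; apply: (form_slot_eq0 (j := p) formB).
    apply/funext => w; apply/eqP; rewrite /flat subr_eq0; apply/eqP.
    rewrite canonical_form_fcons => [|i]; last exact: epsL.
    by rewrite exchange_big; exact: flatE.
  rewrite omega_e canonical_form_eq0 ?subrr // => a J p.
  exact: (DB (inr (a, J)) (inl (val I p))).
Qed.
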